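(* Let $(A,d)$ be a differential graded commutative algebra with unit over a field $\mathbb{K}$ of characteristic $0$, let $\boldsymbol{i}\colon A\to A$ be a quasi-BV operator of even degree $-2k$, let $\boldsymbol{l}=[\boldsymbol{i},d]$, and assume that $[\boldsymbol{l},\boldsymbol{i}]$ is also a quasi-BV operator on $A$. Let $[\,,\,]_{\boldsymbol{l}}$ be the bracket of degree $-2k+1$ on $A$ defined by \[[a,b]_{\boldsymbol{l}}=(-1)^{\bar a}\big(\boldsymbol{l}(ab)-\boldsymbol{l}(a)b\big)-a\boldsymbol{l}(b).\] Then $(A,d,\cdot,[\,,\,]_{\boldsymbol{l}})$ is a Gerstenhaber algebra whose underlying DGLA $(A[2k-1],d,[\,,\,]_{\boldsymbol{l}})$ is homotopy abelian. If moreover $\boldsymbol{l}^2=0$, then $(A,d,\cdot,[\,,\,]_{\boldsymbol{l}},\boldsymbol{l})$ is a Batalin–Vilkovisky algebra.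
   Context: $[\,,\,]$ on linear endomorphisms of $A$ is the graded commutator; $\bar a$ denotes degree; $A[2k-1]^i=A^{i+2k-1}$. A homogeneous linear map $f\colon A\to A$ is a quasi-BV operator if $f(1)=0$ and $f$ is a differential operator of order $\le 2$, i.e. $[[[f,a],b],c]=0$ for all $a,b,c\in A$ (elements acting by left multiplication); equivalently, $\Phi(a,b)=f(ab)-f(a)b-(-1)^{\bar a\bar f}af(b)$ satisfies $\Phi(a,bc)=\Phi(a,b)c+(-1)^{(\bar a+\bar f)\bar b}b\Phi(a,c)$. Here a Gerstenhaber algebra structure means that $[\,,\,]_{\boldsymbol l}$ makes $(A[2k-1],d)$ a differential graded Lie algebra and satisfies the Poisson (Leibniz) identity with respect to the product of $A$. A DGLA is homotopy abelian if it is quasi-isomorphic to a DGLA with zero bracket. A Batalin–Vilkovisky algebra is a graded commutative algebra with a quasi-BV operator $\Delta$ of odd degree with $\Delta^2=0$ (here together with the differential $d$). *)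

(* Defs.v *)
From HB Require Import structures.
From mathcomp Require Import all_boot all_order all_algebra.
From Stdlib Require Import ClassicalEpsilon.
Set Implicit Arguments. Unset Strict Implicit. Unset Printing Implicit Defensive.
Import Order.TTheory GRing.Theory Num.Theory.
Local Open Scope ring_scope.

Section Graded.
Variable K : fieldType.

Definition sgn (n : int) : K := if odd (absz n) then -1 else 1.

Section OnModule.
Variable V : lmodType K.

(* A Z-grading of V given by the family of projections pi n : V -> V onto the
   degree-n component V^n: the pi n are linear, pairwise orthogonal idempotents,
   and every vector is the (finite) sum of its homogeneous components. *)
Definition is_grading (pi : int -> V -> V) : Prop :=
  [/\ forall n (c : K) (x y : V), pi n (c *: x + y) = c *: pi n x + pi n y,
      forall n m x, pi n (pi m x) = if n == m then pi n x else 0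
    & forall x, exists s : seq int, uniq s /\ x = \sum_(n <- s) pi n x].

Definition homog (pi : int -> V -> V) (n : int) (x : V) : Prop := pi n x = x.

Definition is_lin (f : V -> V) : Prop :=
  forall (c : K) (x y : V), f (c *: x + y) = c *: f x + f y.

Definition op_deg (pi : int -> V -> V) (p : int) (f : V -> V) : Prop :=
  forall n x, homog pi n x -> homog pi (n + p) (f x).

Definition gcomm (p q : int) (f g : V -> V) : V -> V :=
  fun x => f (g x) - sgn (p * q) *: g (f x).

(* the parity operator a |-> (-1)^{deg a} a, extended linearly *)
Definition parity (pi : int -> V -> V) (x : V) : V :=
  let s := epsilon (inhabits [::])
             (fun s : seq int => uniq s /\ x = \sum_(n <- s) pi n x) in
  \sum_(n <- s) sgn n *: pi n x.
End OnModule.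

Record dgla := DGLA {
  dg_car : lmodType K;
  dg_pi : int -> dg_car -> dg_car;
  dg_d : dg_car -> dg_car;
  dg_br : dg_car -> dg_car -> dg_car }.
Arguments dg_pi : clear implicits.
Arguments dg_d : clear implicits.
Arguments dg_br : clear implicits.

Definition is_dgla (L : dgla) : Prop :=
  let pi := dg_pi L in let d := dg_d L in let br := dg_br L in
  is_grading pi /\ is_lin d /\ op_deg pi 1 d /\ (forall x, d (d x) = 0) /\
      (forall a, is_lin (br a)) /\ (forall b, is_lin (fun a => br a b)) /\
      (forall m n a b, homog pi m a -> homog pi n b -> homog pi (m + n) (br a b)) /\
      (forall m n a b, homog pi m a -> homog pi n b ->
          br a b = - (sgn (m * n) *: br b a)) /\
      (forall m n a b c, homog pi m a -> homog pi n b ->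
          br a (br b c) = br (br a b) c + sgn (m * n) *: br b (br a c)) /\
      (forall m a b, homog pi m a ->
          d (br a b) = br (d a) b + sgn m *: br a (d b)).

Definition is_dgla_morph (L M : dgla) (f : dg_car L -> dg_car M) : Prop :=
  [/\ forall (c : K) x y, f (c *: x + y) = c *: f x + f y,
      forall n x, f (dg_pi L n x) = dg_pi M n (f x),
      forall x, f (dg_d L x) = dg_d M (f x)
    & forall x y, f (dg_br L x y) = dg_br M (f x) (f y)].

Definition is_quasi_iso (L M : dgla) (f : dg_car L -> dg_car M) : Prop :=
  is_dgla_morph f /\
  forall n : int,
    (forall x, homog (dg_pi L) n x -> dg_d L x = 0 ->
       (exists y', dg_d M y' = f x) -> exists y, dg_d L y = x) /\
    (forall y, homog (dg_pi M) n y -> dg_d M y = 0 ->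
       exists x, [/\ homog (dg_pi L) n x, dg_d L x = 0 &
                     exists z, f x - y = dg_d M z]).

Inductive qi_equiv : dgla -> dgla -> Prop :=
  | qi_refl L : qi_equiv L L
  | qi_step L M (f : dg_car L -> dg_car M) :
      is_dgla L -> is_dgla M -> is_quasi_iso f -> qi_equiv L M
  | qi_sym L M : qi_equiv L M -> qi_equiv M L
  | qi_trans L M N : qi_equiv L M -> qi_equiv M N -> qi_equiv L N.

Definition homotopy_abelian (L : dgla) : Prop :=
  exists M : dgla, [/\ is_dgla M, (forall x y, dg_br M x y = 0) & qi_equiv L M].

Section Alg.
Variable A : algType K.

Definition lmul (a : A) : A -> A := fun x => a * x.

Definition is_dgca (pi : int -> A -> A) (d : A -> A) : Prop :=
  is_grading pi /\ homog pi 0 1 /\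
      (forall m n a b, homog pi m a -> homog pi n b -> homog pi (m + n) (a * b)) /\
      (forall m n a b, homog pi m a -> homog pi n b -> a * b = sgn (m * n) *: (b * a)) /\
      is_lin d /\ op_deg pi 1 d /\ (forall x, d (d x) = 0) /\
      (forall m a b, homog pi m a -> d (a * b) = d a * b + sgn m *: (a * d b)).

(* quasi-BV operator of degree p: f(1) = 0 and f is a differential operator of
   order <= 2, i.e. [[[f,a],b],c] = 0 (a, b, c acting by left multiplication) *)
Definition quasi_BV (pi : int -> A -> A) (p : int) (f : A -> A) : Prop :=
  [/\ is_lin f, op_deg pi p f, f 1 = 0
    & forall m n q a b c, homog pi m a -> homog pi n b -> homog pi q c ->
        forall x, gcomm (p + m + n) q
                    (gcomm (p + m) n (gcomm p m f (lmul a)) (lmul b)) (lmul c) x = 0].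

(* the bracket [a,b]_l = (-1)^{deg a} (l(ab) - l(a) b) - a l(b) (for homogeneous a),
   extended bilinearly *)
Definition bracket_l (pi : int -> A -> A) (l : A -> A) (a b : A) : A :=
  l (parity pi a * b) - l (parity pi a) * b - a * l b.

Definition shift_grading (pi : int -> A -> A) (s : int) : int -> A -> A :=
  fun n => pi (n + s).

Definition shifted_dgla (pi : int -> A -> A) (s : int) (d : A -> A)
  (br : A -> A -> A) : dgla := @DGLA A (shift_grading pi s) d br.

(* Gerstenhaber algebra with bracket of degree -s (s = 2k-1): (A[s], d, br) is a
   DGLA and the Poisson identity holds *)
Definition is_gerstenhaber (pi : int -> A -> A) (d : A -> A) (s : int)
  (br : A -> A -> A) : Prop :=
  is_dgca pi d /\ is_dgla (shifted_dgla pi s d br) /\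
  forall m n a b c, homog pi m a -> homog pi n b ->
    br a (b * c) = br a b * c + sgn ((m - s) * n) *: (b * br a c).

Definition is_dgBV (pi : int -> A -> A) (d : A -> A) (p : int) (Delta : A -> A) : Prop :=
  [/\ is_dgca pi d, odd (absz p), quasi_BV pi p Delta,
      forall x, Delta (Delta x) = 0
    & forall x, gcomm p 1 Delta d x = 0].
End Alg.
End Graded.

(* Main.v *)
Require Import Defs.
From HB Require Import structures.
From mathcomp Require Import all_boot all_order all_algebra.
From mathcomp Require Import zify.
From Stdlib Require Import ClassicalEpsilon.
Set Implicit Arguments. Unset Strict Implicit. Unset Printing Implicit Defensive.
Import GRing.Theory.
Local Open Scope ring_scope.

(** For an operator [f] put Phi_f(a,b) = f(ab) - f(a)b - (-1)^(|f||a|) a f(b), and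
    let psi(a,b) = - (-1)^|a| Phi_i(a,b).  Since [d] is a derivation and
    l = [i,d], the bracket [a,b]_l = (-1)^|a| Phi_l(a,b) is the differential of
    [psi] in the Hom complex.  Because i, l and [l,i] have order at most 2, the
    Nijenhuis-Richardson bracket of [psi] and [,]_l vanishes (it is the third
    Koszul bracket of [l,i]); applying the differential to this mixed Jacobi
    identity gives twice the Jacobi identity of [,]_l.

    Formally exp(psi) is an L-infinity isomorphism from the abelian algebra to
    (A,[,]_l).  It is realised by strict quasi-isomorphisms as follows: on
    A[t,dt] the differential d + dt d/dt and the bracket t [,]_l + dt psi form
    a DGLA, again by the mixed Jacobi identity, and by the Poincare lemma its
    evaluations at t = 1 and t = 0 are quasi-isomorphisms onto (A,d,[,]_l) and
    (A,d,0). *)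

(** * Reflexive decision procedure for formal identities in abelian groups *)

Inductive zexp := ZVar of nat | ZZero | ZAdd of zexp & zexp | ZOpp of zexp.

Fixpoint zval (V : zmodType) (env : seq V) (e : zexp) : V :=
  match e with
  | ZVar n => env`_n
  | ZZero => 0
  | ZAdd e1 e2 => zval env e1 + zval env e2
  | ZOpp e1 => - zval env e1
  end.

Fixpoint zcoef (e : zexp) (n : nat) : int :=
  match e with
  | ZVar m => (m == n)%:Z
  | ZZero => 0
  | ZAdd e1 e2 => zcoef e1 n + zcoef e2 n
  | ZOpp e1 => - zcoef e1 n
  end.

Fixpoint zbound (N : nat) (e : zexp) : bool :=
  match e with
  | ZVar n => (n < N)%N
  | ZZero => true
  | ZAdd e1 e2 => zbound N e1 && zbound N e2
  | ZOpp e1 => zbound N e1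
  end.

Lemma zval_coef (V : zmodType) (env : seq V) N e :
  zbound N e -> zval env e = \sum_(n < N) env`_n *~ zcoef e n.
Proof.
elim: e => [m|||] /=.
- move=> ltmN; rewrite (bigD1 (Ordinal ltmN)) //= eqxx mulr1z big1 ?addr0 // => j.
  by rewrite -val_eqE /= eq_sym => /negPf ->; rewrite mulr0z.
- by move=> _; rewrite big1.
- move=> e1 IH1 e2 IH2 /andP[/IH1-> /IH2->]; rewrite -big_split /=.
  by apply: eq_bigr => j _; rewrite mulrzDr.
- by move=> e IH /IH->; rewrite -sumrN; apply: eq_bigr => j _; rewrite mulrNz.
Qed.

Definition zdec (N : nat) (e1 e2 : zexp) : bool :=
  [&& zbound N e1, zbound N e2 & all (fun n => zcoef e1 n == zcoef e2 n) (iota 0 N)].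

Lemma zdecP (V : zmodType) (env : seq V) e1 e2 :
  zdec (size env) e1 e2 -> zval env e1 = zval env e2.
Proof.
case/and3P=> b1 b2 /allP eq12; rewrite (zval_coef env b1) (zval_coef env b2).
by apply: eq_bigr => j _; rewrite (eqP (eq12 j _)) // mem_iota /=.
Qed.

(* Atoms are compared up to unification: the same product may be elaborated
   through different paths of the algebraic hierarchy. *)
Ltac zindex x env :=
  lazymatch env with
  | ?y :: ?env' =>
    match constr:(tt) with
    | _ => let _ := match constr:(tt) with _ => unify x y end in constr:(0%N)
    | _ => let n := zindex x env' in constr:(n.+1)
    end
  end.

Ltac zmem x env :=
  lazymatch env with
  | ?y :: ?env' =>
    match constr:(tt) with
    | _ => let _ := match constr:(tt) with _ => unify x y end in constr:(true)
    | _ => zmem x env'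
    end
  | _ => constr:(false)
  end.

Ltac zatoms e env :=
  lazymatch e with
  | ?x + ?y => let env' := zatoms x env in zatoms y env'
  | - ?x => zatoms x env
  | 0 => env
  | _ => let b := zmem e env in
         lazymatch b with true => env | false => constr:(e :: env) end
  end.

Ltac zquote e env :=
  lazymatch e with
  | ?x + ?y => let a := zquote x env in let b := zquote y env in constr:(ZAdd a b)
  | - ?x => let a := zquote x env in constr:(ZOpp a)
  | 0 => constr:(ZZero)
  | _ => let n := zindex e env in constr:(ZVar n)
  end.

Ltac zmodule :=
  lazymatch goal with
  | |- ?x = ?y =>
    let T := type of x in
    let env0 := zatoms x (@nil T) in
    let env := zatoms y env0 in
    let e1 := zquote x env in
    let e2 := zquote y env in
    exact: (@zdecP _ env e1 e2 erefl)
  end.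

(** Reduces a goal to a known equation [z = t]: the remaining equality of differences is purely
    formal and is left to [zmodule]. *)
Lemma eq_by_add (V : zmodType) (x y z t : V) : z = t -> x - y = z - t -> x = y.
Proof. by move=> -> /eqP; rewrite subrr subr_eq0 => /eqP. Qed.

Lemma eq_by_sub (V : zmodType) (x y z t : V) : z = t -> x - y = t - z -> x = y.
Proof. by move=> ->; apply: eq_by_add. Qed.

Lemma eq_addr (V : zmodType) (x y z t : V) : x = y -> z = t -> x + z = y + t.
Proof. by move=> -> ->. Qed.

Ltac zmodule_from E :=
  first [apply: (eq_by_add E); zmodule | apply: (eq_by_sub E); zmodule].

(** * Super-commutative rings *)

(** Koszul signs are carried by Booleans, so that a case split on parities turns every sign into a
    plain opposite and leaves a goal for [zmodule]. *)
Definition signed (V : zmodType) (b : bool) (x : V) : V := if b then - x else x.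

Section SuperCommutative.
(* [H b x] reads: [x] is homogeneous of parity [b]. *)
Variables (A : nzRingType) (H : bool -> A -> Prop).
Hypothesis HM : forall u v a b, H u a -> H v b -> H (u (+) v) (a * b).
Hypothesis HC : forall u v a b, H u a -> H v b -> a * b = signed (u && v) (b * a).

(** This is [Phi_f(a,b)]; the parities [p] of [f] and [u] of [a] are explicit arguments. *)
Definition defect (p u : bool) (f : A -> A) (a b : A) : A :=
  f (a * b) - f a * b - signed (p && u) (a * f b).

(** The seven-term identity of a differential operator of order at most 2 that kills [1], solved for
    the triple product so that it can serve as a rewriting rule. *)
Definition second_order (p : bool) (f : A -> A) : Prop :=
  forall u v w a b c, H u a -> H v b -> H w c ->
  f (a * (b * c)) = f (a * b) * c + signed (p && u) (a * f (b * c))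
    + signed (v && w) (f (a * c) * b) - f a * (b * c)
    - signed (p && u) (a * (f b * c)) - signed (p && (u (+) v)) (a * (b * f c)).

Definition additive_op (p : bool) (f : A -> A) : Prop :=
  (forall x y, f (x + y) = f x + f y) /\ (forall u a, H u a -> H (p (+) u) (f a)).

Lemma additive_opN p f : additive_op p f -> forall x, f (- x) = - f x.
Proof.
case=> fD _ x; have f0 : f 0 = 0 by apply: (addrI (f 0)); rewrite -fD !addr0.
by apply: (addrI (f x)); rewrite -fD !subrr.
Qed.

Lemma signedP (f : A -> A) : (forall x, f (- x) = - f x) ->
  forall b x, f (signed b x) = signed b (f x).
Proof. by move=> fN []. Qed.

Lemma mulr_signed b x y : x * signed b y = signed b (x * y) :> A.
Proof. by case: b; rewrite //= mulrN. Qed.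

Lemma signed_mulr b x y : signed b x * y = signed b (x * y) :> A.
Proof. by case: b; rewrite //= mulNr. Qed.

(** Up to the seven-term identities of [l] and [i], this is the seven-term identity of [[l,i]],
    which equals [li - il] because [i] is even. *)
Lemma defect_jacobi l i u v w a b c :
  additive_op true l -> additive_op false i ->
  second_order true l -> second_order false i ->
  second_order true (fun x => l (i x) - i (l x)) ->
  H u a -> H v b -> H w c ->
  defect true (u (+) v) l (defect false u i a b) c
  + signed (v && w) (defect true (u (+) w) l (defect false u i a c) b)
  + defect true u l a (defect false v i b c)
  = defect false (~~ (u (+) v)) i (defect true u l a b) c
  + signed (v && w) (defect false (~~ (u (+) w)) i (defect true u l a c) b)
  + signed u (defect false u i a (defect true v l b c)).
Proof.
move=> Al Ai Sl Si Sli Ha Hb Hc.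
have [lD lH] := Al; have [iD iH] := Ai.
have lN := additive_opN Al; have iN := additive_opN Ai.
have lS := signedP lN; have iS := signedP iN.
have := Sli _ _ _ _ _ _ Ha Hb Hc.
rewrite (Si _ _ _ _ _ _ Ha Hb Hc) (Sl _ _ _ _ _ _ Ha Hb Hc) /defect.
have Hia := iH _ _ Ha; have Hib := iH _ _ Hb; have Hic := iH _ _ Hc.
have Hla := lH _ _ Ha; have Hlb := lH _ _ Hb; have Hlc := lH _ _ Hc.
(* These rules move the factor coming from [b] in front of the one coming from [c], so that equal
   monomials become identical atoms. *)
have Cbc := HC Hc Hb; have Cbic := HC Hic Hb; have Cblc := HC Hlc Hb.
have Cibc := HC Hc Hib; have Clbc := HC Hc Hlb.
have Clbic := HC Hic Hlb; have Ciblc := HC Hlc Hib.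
(* The identity of each operator is also needed on triples in which one entry has been replaced by
   its image under the other operator. *)
have Sia := Sl _ _ _ _ _ _ Hia Hb Hc.
have Sib := Sl _ _ _ _ _ _ Ha Hib Hc.
have Sic := Sl _ _ _ _ _ _ Ha Hb Hic.
have Sla := Si _ _ _ _ _ _ Hla Hb Hc.
have Slb := Si _ _ _ _ _ _ Ha Hlb Hc.
have Slc := Si _ _ _ _ _ _ Ha Hb Hlc.
rewrite !(lD, lN, lS, iD, iN, iS).
rewrite !(mulrDl, mulrDr, mulrN, mulNr, mulr_signed, signed_mulr).
rewrite !(lD, lN, lS, iD, iN, iS).
rewrite -!mulrA.
rewrite ?(Cbc, Cbic, Cblc, Cibc, Clbc, Clbic, Ciblc).
rewrite ?(lS, iS, mulr_signed).
rewrite ?(Sia, Sib, Sic, Sla, Slb, Slc).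
rewrite ?(Cbc, Cbic, Cblc, Cibc, Clbc, Clbic, Ciblc).
rewrite ?(lS, iS, mulr_signed).
rewrite -?mulrA.
by case: u v w {Ha Hb Hc Hia Hib Hic Hla Hlb Hlc Cbc Cbic Cblc Cibc Clbc Clbic
  Ciblc Sia Sib Sic Sla Slb Slc} => [] [] []; rewrite /signed /= => E; zmodule_from E.
Qed.


(** The value at [x] of [[[[f,a],b],c]], with signs read off from parities only. *)
Definition tricomm (p u v w : bool) (f : A -> A) (a b c x : A) : A :=
  let g1 y := f (a * y) - signed (p && u) (a * f y) in
  let g2 y := g1 (b * y) - signed ((p (+) u) && v) (b * g1 y) in
  g2 (c * x) - signed ((p (+) u (+) v) && w) (c * g2 x).

(** At [1] the triple commutator has eight terms; the one containing [f 1] vanishes, and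
    super-commutativity puts the other seven in the required order. *)
Lemma second_order_tricomm p f : additive_op p f -> f 1 = 0 ->
  (forall u v w a b c, H u a -> H v b -> H w c -> tricomm p u v w f a b c 1 = 0) ->
  second_order p f.
Proof.
move=> Af f1 T0 u v w a b c Ha Hb Hc; have := T0 _ _ _ _ _ _ Ha Hb Hc.
have [fD fH] := Af; rewrite /tricomm !mulr1 f1 !mulr0.
have Hfa := fH _ _ Ha; have Hfb := fH _ _ Hb; have Hfc := fH _ _ Hc.
have Cba := HC Hb Ha; have C5 := HC Hb Hfa.
have C1 := HC Hb (fH _ _ (HM Ha Hc)).
have C2 := HC Hc (fH _ _ (HM Ha Hb)).
have C3 := HC Hc (HM Ha Hfb); have C4 := HC Hc (HM Hfa Hb).
have S0 q : signed q (0 : A) = 0 by case: q; rewrite /= ?oppr0.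
rewrite !S0 !subr0 C5 !(mulrDr, mulrN, mulr_signed) C1 C2 C3 C4.
rewrite [b * (a * _)]mulrA Cba !signed_mulr -!mulrA.
by case: p u v w {Af fH T0 Ha Hb Hc Hfa Hfb Hfc Cba C1 C2 C3 C4 C5}
  => [] [] [] []; rewrite /signed /= => E; zmodule_from E.
Qed.

Section Derivation.
Variable d : A -> A.
Hypothesis Ad : additive_op true d.
Hypothesis dM : forall u a b, H u a -> d (a * b) = d a * b + signed u (a * d b).

(** The commutator with [d] obeys the Leibniz rule on iterated commutators, and the commutator of
    [d] with multiplication by [a] is multiplication by [d a]. Hence the order bound passes from [i]
    to [[i,d]]. *)
Lemma tricomm_derivation i u v w a b c x : additive_op false i ->
  H u a -> H v b -> H w c ->
  tricomm true u v w (fun y => i (d y) - d (i y)) a b c x =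
  tricomm false (~~ u) v w i (d a) b c x
  + signed u (tricomm false u (~~ v) w i a (d b) c x)
  + signed (u (+) v) (tricomm false u v (~~ w) i a b (d c) x)
  + signed (u (+) v (+) w) (tricomm false u v w i a b c (d x))
  - d (tricomm false u v w i a b c x).
Proof.
move=> Ai Ha Hb Hc; have [iD iH] := Ai; have [dD dH] := Ad.
have iN := additive_opN Ai; have dN := additive_opN Ad.
have iS := signedP iN; have dS := signedP dN.
have da := dM _ Ha; have db := dM _ Hb; have dc := dM _ Hc.
rewrite /tricomm.
rewrite !(dD, dN, dS, iD, iN, iS, mulrDr, mulrN, mulr_signed, da, db, dc).
by case: u v w {Ha Hb Hc da db dc} => [] [] []; rewrite /signed /=; zmodule.
Qed.

Lemma defect_derivation i u v a b : additive_op false i ->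
  H u a -> H v b ->
  defect true u (fun y => i (d y) - d (i y)) a b =
  defect false (~~ u) i (d a) b + signed u (defect false u i a (d b))
  - d (defect false u i a b).
Proof.
move=> Ai Ha Hb; have [iD iH] := Ai; have [dD dH] := Ad.
have iN := additive_opN Ai; have dN := additive_opN Ad.
have iS := signedP iN; have dS := signedP dN.
have da := dM _ Ha; have dia := dM _ (iH _ _ Ha).
rewrite /defect !(dD, dN, dS, iD, iN, iS, da, dia, mulrDr, mulrDl, mulrN, mulNr).
by case: u {Ha da dia} => /=; rewrite /signed /=; zmodule.
Qed.
End Derivation.

Lemma defectC p f u v a b : additive_op p f -> H u a -> H v b ->
  defect p u f a b = signed (u && v) (defect p v f b a).
Proof.
move=> Af Ha Hb; have [fD fH] := Af; have fS := signedP (additive_opN Af).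
rewrite /defect (HC Ha Hb) fS (HC (fH _ _ Ha) Hb) (HC Ha (fH _ _ Hb)).
by case: p u v {Af Ha Hb fH} => [] [] []; rewrite /signed /=; zmodule.
Qed.

(** A rearrangement of the seven-term identity; it becomes the Poisson identity of the bracket. *)
Lemma defect_biderivation p f u v w a b c : additive_op p f -> second_order p f ->
  H u a -> H v b -> H w c ->
  defect p u f a (b * c) =
  defect p u f a b * c + signed ((p (+) u) && v) (b * defect p u f a c).
Proof.
move=> Af Sf Ha Hb Hc; have [fD fH] := Af.
rewrite /defect (Sf _ _ _ _ _ _ Ha Hb Hc).
rewrite !(mulrDr, mulrDl, mulrN, mulNr, mulr_signed, signed_mulr) -!mulrA.
have Cba := HC Hb Ha.
rewrite (HC Hb (fH _ _ (HM Ha Hc))) [b * (a * _)]mulrA Cba.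
rewrite [b * (f a * _)]mulrA (HC Hb (fH _ _ Ha)) !signed_mulr -!mulrA.
by case: p u v w {Af Sf Ha Hb Hc fH Cba} => [] [] [] []; rewrite /signed /=; zmodule.
Qed.
End SuperCommutative.

(** * Graded modules and derived brackets *)

Lemma oddzD (m n : int) : odd `|m + n| = odd `|m| (+) odd `|n|. Proof. lia. Qed.

Lemma oddzM (m n : int) : odd `|m * n| = odd `|m| && odd `|n|.
Proof. by rewrite abszM oddM. Qed.

Lemma oddzN (m : int) : odd `|- m| = odd `|m|.
Proof. by rewrite abszN. Qed.

Definition oddzE := (oddzD, oddzM, oddzN).

Lemma sgn_signed (K : fieldType) (V : lmodType K) (m : int) (x : V) :
  sgn K m *: x = signed (odd `|m|) x.
Proof. by rewrite /sgn /signed; case: odd; rewrite ?scale1r ?scaleN1r. Qed.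

Section Linear.
Variables (K : fieldType) (U V : lmodType K) (f : U -> V).
Hypothesis fL : forall (c : K) x y, f (c *: x + y) = c *: f x + f y.

Lemma linD x y : f (x + y) = f x + f y.
Proof. by have := fL 1 x y; rewrite !scale1r. Qed.

Lemma lin0 : f 0 = 0.
Proof. by apply: (addrI (f 0)); rewrite -linD !addr0. Qed.

Lemma linZ c x : f (c *: x) = c *: f x.
Proof. by have := fL c x 0; rewrite lin0 !addr0. Qed.

Lemma linN x : f (- x) = - f x.
Proof. by rewrite -scaleN1r linZ scaleN1r. Qed.

Lemma linS b x : f (signed b x) = signed b (f x).
Proof. by case: b; rewrite //= linN. Qed.

Lemma scalerS c b x : c *: signed b x = signed b (c *: x) :> V.
Proof. by case: b; rewrite //= scalerN. Qed.

Lemma lin_sum (I : Type) (r : seq I) (F : I -> U) :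
  f (\sum_(j <- r) F j) = \sum_(j <- r) f (F j).
Proof. by elim: r => [|j r IH]; rewrite ?big_nil ?lin0 // !big_cons linD IH. Qed.
End Linear.

Section Grading.
Variables (K : fieldType) (V : lmodType K) (pi : int -> V -> V).
Hypothesis gr : is_grading pi.

Lemma pi_lin n : is_lin (pi n).
Proof. by case: gr => piL _ _; apply: piL. Qed.

Lemma pi_pi n m x : pi n (pi m x) = if n == m then pi n x else 0.
Proof. by case: gr. Qed.

Lemma homog_pi n x : homog pi n (pi n x).
Proof. by rewrite /homog pi_pi eqxx. Qed.

Lemma homogZ n (c : K) x : homog pi n x -> homog pi n (c *: x).
Proof. by rewrite /homog (linZ (pi_lin n)) => ->. Qed.

Lemma homog0 n : homog pi n 0.
Proof. exact: lin0 (pi_lin n). Qed.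

Lemma homogD n x y : homog pi n x -> homog pi n y -> homog pi n (x + y).
Proof. by rewrite /homog (linD (pi_lin n)) => -> ->. Qed.

Lemma homogS n b x : homog pi n x -> homog pi n (signed b x).
Proof. by rewrite /homog (linS (pi_lin n)) => ->. Qed.

Lemma homogN n x : homog pi n x -> homog pi n (- x).
Proof. exact: (@homogS n true x). Qed.

Lemma homog_ind (P : V -> Prop) :
  P 0 -> (forall x y, P x -> P y -> P (x + y)) ->
  (forall n x, homog pi n x -> P x) -> forall x, P x.
Proof.
move=> P0 PD Ph x; case: gr => _ _ /(_ x)[s [_ ->]].
by apply: big_ind => // n _; apply: Ph (homog_pi n x).
Qed.

Lemma pi_eq0 x : (forall n, pi n x = 0) -> x = 0.
Proof. by move=> x0; case: gr => _ _ /(_ x)[s [_ ->]]; apply: big1. Qed.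

Lemma pi_sum_supp s x m : uniq s ->
  pi m (\sum_(n <- s) pi n x) = if m \in s then pi m x else 0.
Proof.
move=> us; rewrite (lin_sum (pi_lin m)); under eq_bigr do rewrite pi_pi.
case: ifPn => ms.
  rewrite (bigD1_seq m) //= eqxx big1 ?addr0 // => n.
  by rewrite eq_sym => /negPf->.
rewrite big1_seq // => n /andP[_ ns]; case: eqP => // mn.
by rewrite mn ns in ms.
Qed.

Lemma sum_supp s x : uniq s -> (forall n, n \notin s -> pi n x = 0) ->
  x = \sum_(n <- s) pi n x.
Proof.
move=> us xs; apply/eqP; rewrite -subr_eq0; apply/eqP/pi_eq0 => m.
rewrite (linD (pi_lin m)) (linN (pi_lin m)) (pi_sum_supp _ _ us).
by case: ifPn => [_|/xs->]; rewrite ?subrr ?subr0.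
Qed.

Lemma ex_supp x : exists s : seq int, forall n, n \notin s -> pi n x = 0.
Proof.
case: gr => _ _ /(_ x)[s [us xs]]; exists s => n ns.
by rewrite xs (pi_sum_supp _ _ us) (negPf ns).
Qed.

(** Makes the choice hidden in [parity] harmless: two lists containing all nonzero components differ
    only by indices whose components vanish. *)
Lemma parity_supp s x : uniq s -> (forall n, n \notin s -> pi n x = 0) ->
  parity pi x = \sum_(n <- s) sgn K n *: pi n x.
Proof.
move=> us xs; rewrite /parity; set P := fun _ => _.
have [us' xs'] : P (epsilon (inhabits [::]) P).
  by apply: epsilon_spec; exists s; split; [|apply: sum_supp].
set s' := epsilon _ _ in us' xs' *.
have zs' n : n \notin s' -> pi n x = 0.
  by move=> ns; rewrite xs' (pi_sum_supp _ _ us') (negPf ns).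
(* Enlarging the index list does not change the sum, so both lists can be compared with their union
   [t]. *)
have restrict (r : seq int) (F : int -> V) : (forall n, n \notin r -> F n = 0) ->
    uniq r -> forall t, uniq t -> {subset r <= t} ->
    \sum_(n <- t) F n = \sum_(n <- r) F n.
  move=> Fr ur t ut rt; rewrite (bigID (mem r)) /= [X in _ + X]big1 ?addr0.
    rewrite -big_filter; apply: perm_big; apply: uniq_perm; rewrite ?filter_uniq //.
    by move=> n; rewrite mem_filter; case: (boolP (n \in r)) => //= /rt->.
  by move=> n; apply: Fr.
pose t := undup (s ++ s').
rewrite -(restrict s _ _ us t) ?undup_uniq ?(restrict s' _ _ us' t) ?undup_uniq //.
- by move=> n /zs'->; rewrite scaler0.
- by move=> n ns; rewrite mem_undup mem_cat ns orbT.
- by move=> n /xs->; rewrite scaler0.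
- by move=> n ns; rewrite mem_undup mem_cat ns.
Qed.

Lemma parity_lin : is_lin (parity pi).
Proof.
move=> c x y; have [s1 xs] := ex_supp x; have [s2 ys] := ex_supp y.
pose s := undup (s1 ++ s2).
have us : uniq s by apply: undup_uniq.
have xs' n : n \notin s -> pi n x = 0.
  by rewrite mem_undup mem_cat negb_or => /andP[/xs].
have ys' n : n \notin s -> pi n y = 0.
  by rewrite mem_undup mem_cat negb_or => /andP[_ /ys].
rewrite !(@parity_supp s) // => [|n ns]; last first.
  by rewrite pi_lin xs' ?ys' // scaler0 addr0.
rewrite scaler_sumr -big_split /=; apply: eq_bigr => n _.
by rewrite pi_lin scalerDr !scalerA mulrC.
Qed.

Lemma parity_homog n x : homog pi n x -> parity pi x = signed (odd `|n|) x.
Proof.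
move=> xn; rewrite (@parity_supp [:: n]) ?big_seq1 ?xn ?sgn_signed // => m.
by rewrite inE -xn pi_pi => /negPf->.
Qed.

Lemma shift_gradingP s : is_grading (fun n => pi (n + s)).
Proof.
split=> [n c x y|n m x|x]; first exact: pi_lin.
  by rewrite pi_pi (inj_eq (addIr s)).
case: gr => _ _ /(_ x)[r [ur xr]]; exists [seq n - s | n <- r]; split.
  by rewrite map_inj_uniq //; apply: addIr.
by rewrite big_map; under eq_bigr do rewrite subrK.
Qed.
End Grading.

(** Degrees are those of the shifted grading, where [br] has degree 0 and [psi] degree -1. The field
    [db_brE] says that [br] is the differential of [psi] in the Hom complex, and [db_mixed_jacobi]
    that the Nijenhuis-Richardson bracket of [psi] and [br] vanishes. *)
Record derived_bracket (K : fieldType) (V : lmodType K) (pi : int -> V -> V)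
    (d : V -> V) (psi br : V -> V -> V) : Prop := DerivedBracket {
  db_grading : is_grading pi;
  db_diff_lin : is_lin d;
  db_diff_deg : op_deg pi 1 d;
  db_diffK : forall x, d (d x) = 0;
  db_psi_linr : forall a, is_lin (psi a);
  db_psi_linl : forall b, is_lin (psi^~ b);
  db_br_linr : forall a, is_lin (br a);
  db_br_linl : forall b, is_lin (br^~ b);
  db_psi_deg : forall m n a b, homog pi m a -> homog pi n b ->
    homog pi (m + n - 1) (psi a b);
  db_psiC : forall m n a b, homog pi m a -> homog pi n b ->
    psi a b = - signed (odd `|m| && odd `|n|) (psi b a);
  db_brE : forall m n a b, homog pi m a -> homog pi n b ->
    br a b = d (psi a b) + psi (d a) b + signed (odd `|m|) (psi a (d b));
  db_mixed_jacobi : forall m n q a b c,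
    homog pi m a -> homog pi n b -> homog pi q c ->
    psi a (br b c) + signed (odd `|m|) (br a (psi b c)) =
    psi (br a b) c + br (psi a b) c + signed (odd `|m| && odd `|n|)
      (psi b (br a c) + signed (odd `|n|) (br b (psi a c))) }.

Section DerivedBracket.
Variables (K : fieldType) (V : lmodType K) (pi : int -> V -> V).
Variables (d : V -> V) (psi br : V -> V -> V).
Hypothesis two_neq0 : 2%:R != 0 :> K.
Hypothesis D : derived_bracket pi d psi br.

Let gr := db_grading D.
Let dL := db_diff_lin D.
Let dg := db_diff_deg D.
Let dd := db_diffK D.
Let psiR := db_psi_linr D.
Let psiL := db_psi_linl D.
Let brR := db_br_linr D.
Let brL := db_br_linl D.
Let psig := db_psi_deg D.
Let psiC := db_psiC D.
Let brE := db_brE D.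
Let mixed_jacobi := db_mixed_jacobi D.

Lemma derived_bracket_deg m n a b : homog pi m a -> homog pi n b ->
  homog pi (m + n) (br a b).
Proof.
move=> ha hb; rewrite (brE ha hb); apply: homogD => //; first apply: homogD => //.
- by have := dg (psig ha hb); rewrite subrK.
- by have := psig (dg ha) hb; rewrite addrAC addrK.
- by apply: homogS => //; have := psig ha (dg hb); rewrite addrA addrK.
Qed.

Lemma derived_bracketC m n a b : homog pi m a -> homog pi n b ->
  br a b = - signed (odd `|m| && odd `|n|) (br b a).
Proof.
move=> ha hb; rewrite (brE ha hb) (brE hb ha) (psiC ha hb) (psiC (dg ha) hb).
rewrite (psiC ha (dg hb)) !oddzE !(linN dL, linS dL).
by case: (odd `|m|) (odd `|n|) => [] []; rewrite /signed /=; zmodule.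
Qed.

(** A boundary in the Hom complex is a cycle: after expanding each bracket through [psi], all terms
    cancel because [d] squares to zero. *)
Lemma derived_bracket_derivation m a b : homog pi m a ->
  d (br a b) = br (d a) b + signed (odd `|m|) (br a (d b)).
Proof.
move=> ha; elim/(homog_ind gr): b => [|x y Ex Ey|n b hb].
- by rewrite (lin0 dL) !(lin0 (brR _)) (lin0 dL) add0r; case: odd; rewrite //= oppr0.
- rewrite (linD dL) !(linD (brR _)) (linD dL) Ex Ey.
  by rewrite /signed; case: odd; zmodule.
rewrite (brE ha hb) (brE (dg ha) hb) (brE ha (dg hb)) !dd !(linD dL) !(linS dL) !dd.
rewrite (lin0 (psiL b)) (lin0 (psiR a)) !oddzE.
by case: odd; rewrite /signed /=; zmodule.
Qed.

(* Applying the differential of the Hom complex to the mixed Jacobi identity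
   yields twice the Jacobi identity, because [br] is the differential of [psi]. *)
Lemma derived_bracket_jacobi m n a b c : homog pi m a -> homog pi n b ->
  br a (br b c) = br (br a b) c + signed (odd `|m| && odd `|n|) (br b (br a c)).
Proof.
move=> ha hb; elim/(homog_ind gr): c => [|x y Ex Ey|q c hc].
- by rewrite !(lin0 (brR _)) add0r; case: (_ && _); rewrite //= oppr0.
- by rewrite !(linD (brR _)) Ex Ey /signed; case: (_ && _); zmodule.
have half (x y : V) : x + x = y + y -> x = y.
  by rewrite -!mulr2n -!scaler_nat => /(scalerI two_neq0).
apply: half.
have hda := dg ha; have hdb := dg hb; have hdc := dg hc.
have dbr := derived_bracket_derivation; have hbr := derived_bracket_deg.
(* The differential of the mixed identity in the Hom complex: [d] is applied to its value, then to
   each argument in turn, with the Koszul sign of passing the earlier arguments. *)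
have E0 := mixed_jacobi ha hb hc; have Ea := mixed_jacobi hda hb hc.
have Eb := mixed_jacobi ha hdb hc; have Ec := mixed_jacobi ha hb hdc.
have dE0 := congr1 d E0.
(* Each double bracket is expanded twice through [psi], at its outer bracket in [B1] to [B3] and at
   its inner one in [C1] to [C3]; this is the origin of the factor 2. *)
have B1 := brE ha (hbr _ _ _ _ hb hc); have B2 := brE (hbr _ _ _ _ ha hb) hc.
have B3 := brE hb (hbr _ _ _ _ ha hc).
have C1 := congr1 (br a) (brE hb hc); have C2 := congr1 (br^~ c) (brE ha hb).
have C3 := congr1 (br b) (brE ha hc).
have /eqP := eq_addr (eq_addr (eq_addr dE0 Ea)
  (eq_addr (congr1 (signed (odd `|m|)) Eb)
                (congr1 (signed (odd `|m| (+) odd `|n|)) Ec)))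
  (eq_addr (eq_addr B1 C1) (congr1 -%R (eq_addr (eq_addr B2 C2)
    (congr1 (signed (odd `|m| && odd `|n|)) (eq_addr B3 C3))))).
rewrite !(linD dL, linS dL).
rewrite (dbr _ _ _ ha) (dbr _ _ _ hb) (dbr _ _ _ (psig ha hb)).
rewrite (dbr _ _ _ ha) (dbr _ _ _ hb) (dbr _ _ _ ha).
rewrite !(linD (brR _), linS (brR _), linD (psiR _), linS (psiR _)).
rewrite !(linD (brL _), linS (brL _), linD (psiL _), linS (psiL _)).
rewrite !oddzE => /eqP.
by case: (odd `|m|) (odd `|n|) => [] []; rewrite /signed /= => E; zmodule_from E.
Qed.

Lemma derived_bracket_dgla : is_dgla (DGLA pi d br).
Proof.
do 6![split; first by []]; split; first exact: derived_bracket_deg.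
split=> [m n a b ha hb|]; first by rewrite sgn_signed oddzM; apply: derived_bracketC.
split=> [m n a b c ha hb|m a b ha]; rewrite sgn_signed ?oddzM.
  exact: derived_bracket_jacobi.
exact: derived_bracket_derivation.
Qed.
End DerivedBracket.

(** * Polynomial paths *)

(* [{poly A}] is only a module over [A] in the library; [kpoly A] carries the
   scalar multiplication of the base field of the algebra [A]. *)
Definition kpoly (K : fieldType) (A : algType K) : Type := {poly A}.

Section KPoly.
Variables (K : fieldType) (A : algType K).
Implicit Types (p q : kpoly A) (c : K).

HB.instance Definition _ := GRing.Zmodule.on (kpoly A).

Definition kscale c p : kpoly A := (c%:A : A) *: (p : {poly A}).

Fact kscaleA a c p : kscale a (kscale c p) = kscale (a * c) p.
Proof. by rewrite /kscale scalerA -scalerAl mul1r scalerA. Qed.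
Fact kscale1 : left_id 1 kscale.
Proof. by move=> p; rewrite /kscale !scale1r. Qed.
Fact kscaleDr : right_distributive kscale +%R.
Proof. by move=> c p q; rewrite /kscale scalerDr. Qed.
Fact kscaleDl p : {morph kscale^~ p : a c / a + c}.
Proof. by move=> a c; rewrite /kscale !scalerDl. Qed.
HB.instance Definition _ :=
  GRing.Zmodule_isLmodule.Build K (kpoly A) kscaleA kscale1 kscaleDr kscaleDl.

(** Evaluation is restricted to scalars, which are central, so it is compatible with products even
    though [A] need not be commutative as a ring. *)
Definition ev c p : A := (p : {poly A}).[c%:A].

Lemma exp_alg c n : (c%:A : A) ^+ n = (c ^+ n)%:A.
Proof. by rewrite exprZn expr1n. Qed.

Lemma comm_alg c (x : A) : x * c%:A = c%:A * x.
Proof. by rewrite mulr_algl mulr_algr. Qed.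

Lemma ev_coef c p n : (size (p : {poly A}) <= n)%N ->
  ev c p = \sum_(j < n) c ^+ j *: (p : {poly A})`_j.
Proof.
move=> pn; rewrite /ev (horner_coef_wide _ pn); apply: eq_bigr => j _.
by rewrite exp_alg mulr_algr.
Qed.

Lemma ev_lin c : forall (a : K) p q, ev c (a *: p + q) = a *: ev c p + ev c q.
Proof. by move=> a p q; rewrite /ev hornerD hornerZ mulr_algl. Qed.

Definition tmul p : kpoly A := (p : {poly A}) * 'X.
Definition tder p : kpoly A := (p : {poly A})^`().
Definition pconst (a : A) : kpoly A := a%:P.

Lemma ev_tmul c p : ev c (tmul p) = c *: ev c p.
Proof. by rewrite /ev hornerMX mulr_algr. Qed.

Lemma ev_const c a : ev c (pconst a) = a.
Proof. exact: hornerC. Qed.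

Lemma tder_lin : forall (a : K) p q, tder (a *: p + q) = a *: tder p + tder q.
Proof. by move=> a p q; rewrite /tder derivD derivZ. Qed.

Lemma tder_tmul p : tder (tmul p) = p + tmul (tder p).
Proof. by rewrite /tder /tmul derivM derivX mulr1 addrC. Qed.

Lemma tder_const a : tder (pconst a) = 0.
Proof. exact: derivC. Qed.

Definition polymap (f : A -> A) p : kpoly A := map_poly f (p : {poly A}).

Section Map.
Variable f : A -> A.
Hypothesis fL : is_lin f.

Lemma coef_polymap p j : (polymap f p : {poly A})`_j = f (p : {poly A})`_j.
Proof. exact: coef_map_id0 (lin0 fL). Qed.

Lemma ev_polymap c p : ev c (polymap f p) = f (ev c p).
Proof.
have sz : (size (polymap f p : {poly A}) <= size (p : {poly A}))%N by apply: size_poly.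
rewrite (ev_coef _ sz) (ev_coef c (leqnn (size (p : {poly A})))) (lin_sum fL).
by apply: eq_bigr => j _; rewrite coef_polymap (linZ fL).
Qed.

Lemma tder_polymap p : tder (polymap f p) = polymap f (tder p).
Proof.
apply/polyP => j; rewrite coef_polymap /tder !coef_deriv coef_polymap.
by rewrite -!scaler_nat (linZ fL).
Qed.
End Map.

(** The [K[t]]-bilinear extension of [B]. *)
Definition polymap2 (B : A -> A -> A) p q : kpoly A :=
  \sum_(j < size (p : {poly A})) (polymap (B (p : {poly A})`_j) q : {poly A}) * 'X^j.

Section Map2.
Variable B : A -> A -> A.
Hypotheses (BR : forall a, is_lin (B a)) (BL : forall b, is_lin (B^~ b)).

Lemma polymap2_wide p q n : (size (p : {poly A}) <= n)%N ->
  polymap2 B p q = \sum_(j < n) (polymap (B (p : {poly A})`_j) q : {poly A}) * 'X^j.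
Proof.
move=> pn; rewrite /polymap2.
pose F j := (polymap (B (p : {poly A})`_j) q : {poly A}) * 'X^j.
rewrite (big_ord_widen n F pn) {}/F.
rewrite big_mkcond; apply: eq_bigr => j _; case: ltnP => // sj.
suff -> : polymap (B (p : {poly A})`_j) q = 0 :> {poly A} by rewrite mul0r.
by apply/polyP => i; rewrite (coef_polymap (BR _)) coef0 (nth_default _ sj) (lin0 (BL _)).
Qed.

Lemma ev_polymap2 c p q : ev c (polymap2 B p q) = B (ev c p) (ev c q).
Proof.
rewrite [ev c p](ev_coef _ (leqnn _)) (lin_sum (BL _)) /ev horner_sum.
apply: eq_bigr => j _; rewrite (linZ (BL _)) -(ev_polymap (BR _)).
rewrite hornerM_comm; last by rewrite /comm_poly comm_alg.
by rewrite hornerXn exp_alg mulr_algr.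
Qed.

Lemma tder_polymap2 p q :
  tder (polymap2 B p q) = polymap2 B (tder p) q + polymap2 B p (tder q).
Proof.
have [n pn] : exists n, (size (p : {poly A}) <= n.+1)%N.
  by exists (size (p : {poly A})); apply: leqnSn.
have dpn : (size (tder p : {poly A}) <= n)%N.
  apply/leq_sizeP => j nj; rewrite coef_deriv nth_default ?mul0rn //.
  exact: leq_trans pn _.
rewrite (polymap2_wide q pn) (polymap2_wide (tder q) pn) (polymap2_wide q dpn) /tder.
rewrite (raddf_sum (@deriv A)) /=; under eq_bigr do rewrite derivM derivXn.
rewrite big_split /= addrC; congr (_ + _); last first.
  by apply: eq_bigr => j _; rewrite -(tder_polymap (BR _)).
(* The term of index 0 has no [t]-derivative from its power of [t]; dropping it shifts the index to
   match the coefficients of [tder p]. *)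
rewrite big_ord_recl mulr0n mulr0 add0r; apply: eq_bigr => j _.
apply/polyP => i; rewrite /bump /= coefMXn mulrnAr coefMn coefMXn.
case: ltnP => _; rewrite ?mul0rn // !(coef_polymap (BR _)) coef_deriv.
by rewrite -!scaler_nat (linZ (BL _)).
Qed.
End Map2.

Section CharZero.
Hypothesis char0 : [pchar K] =i pred0.

Lemma natr_neq0 n : n.+1%:R != 0 :> K.
Proof. by rewrite ((pcharf0P K).1 char0). Qed.

(** The usual root count survives zero divisors in [A] because the roots are scalars: after
    splitting off ['X - c], the value at another root [b] is multiplied by the invertible scalar
    [b - c]. *)
Lemma ev_roots (rs : seq K) p : uniq rs -> (size (p : {poly A}) <= size rs)%N ->
  (forall c, c \in rs -> ev c p = 0) -> p = 0.
Proof.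
elim: rs p => [|c rs IH] p /=; first by rewrite size_poly_leq0 => _ /eqP.
case/andP=> crs urs sp p0.
have /factor_theorem[q pq] : root (p : {poly A}) c%:A.
  by apply/rootP; apply: p0; rewrite inE eqxx.
have evp b : ev b p = (b - c) *: ev b q.
  rewrite /ev pq hornerM_comm; last by rewrite /comm_poly comm_alg.
  by rewrite hornerXsubC -scalerBl mulr_algr.
suff q0 : q = 0 by rewrite pq q0 mul0r.
apply: IH => // [|b brs].
  have [->|q_neq0] := eqVneq q 0; first by rewrite size_poly0.
  move: sp; rewrite pq size_Mmonic ?monicXsubC // size_XsubC addn2 /=.
  by rewrite ltnS.
have := p0 b; rewrite inE brs orbT evp => /(_ isT)/eqP; rewrite scaler_eq0.
case/orP=> [|/eqP//]; rewrite subr_eq0 => /eqP bc.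
by rewrite -bc brs in crs.
Qed.

(** Characteristic 0 provides enough distinct scalars, the images of the naturals. Identities
    between polynomial paths may therefore be checked pointwise in [A]. *)
Lemma ev_inj p q : (forall c, ev c p = ev c q) -> p = q.
Proof.
move=> pq; apply/eqP; rewrite -subr_eq0; apply/eqP.
pose N := size (p - q : {poly A}).
apply: (@ev_roots [seq n%:R | n <- iota 0 N]) => [||c _].
- rewrite map_inj_uniq ?iota_uniq // => m n /eqP.
  wlog le_mn : m n / (m <= n)%N => [th|].
    by case: (leqP m n) => [/th//|/ltnW/th h]; rewrite eq_sym => /h.
  rewrite eq_sym -subr_eq0 -natrB // ((pcharf0P K).1 char0) subn_eq0 => le_nm.
  by apply/eqP; rewrite eqn_leq le_mn.
- by rewrite size_map size_iota.
- by rewrite (linD (ev_lin c)) (linN (ev_lin c)) pq subrr.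
Qed.

(** The constant term is zero, since the inverse of [0] is [0] in [K]; the coefficient picked there
    by [j.-1] is irrelevant. *)
Definition primitive q : kpoly A :=
  \poly_(j < (size (q : {poly A})).+1) (j%:R^-1 *: (q : {poly A})`_j.-1).

Lemma tder_primitive q : tder (primitive q) = q.
Proof.
apply/polyP => j; rewrite /tder coef_deriv coef_poly ltnS.
case: ltnP => [_|sj]; last by rewrite mul0rn nth_default.
by rewrite -scaler_nat scalerA divff ?scale1r ?natr_neq0.
Qed.

Lemma tder_eq0 p : tder p = 0 -> p = pconst (ev 0 p).
Proof.
move=> p0; apply/polyP => j; rewrite coefC /ev scale0r horner_coef0.
case: j => // j; have := congr1 (fun r : {poly A} => r`_j) p0.
rewrite /tder coef_deriv coef0 -scaler_nat => /eqP.
by rewrite scaler_eq0 (negPf (natr_neq0 j)) => /eqP.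
Qed.
End CharZero.
End KPoly.

(** * The path DGLA and its evaluations *)

Section PathObject.
Variables (K : fieldType) (A : algType K) (pi : int -> A -> A).
Variables (d : A -> A) (psi br : A -> A -> A).
Hypothesis char0 : [pchar K] =i pred0.
Hypothesis D : derived_bracket pi d psi br.

Let gr := db_grading D.
Let dL := db_diff_lin D.
Let dg := db_diff_deg D.
Let psiR := db_psi_linr D.
Let psiL := db_psi_linl D.
Let brR := db_br_linr D.
Let brL := db_br_linl D.
Let piL := pi_lin gr.
Let PL := parity_lin gr.
Let br_dgla := derived_bracket_dgla (natr_neq0 char0 1) D.

(** The parity is the Koszul sign of moving [dt] across the first argument. *)
Let parbr a b := br (parity pi a) b.

Fact parbrR a : is_lin (parbr a). Proof. exact: brR. Qed.
Fact parbrL b : is_lin (parbr^~ b).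
Proof. by move=> c x y; rewrite /parbr PL (brL b). Qed.

Local Notation forms := (kpoly A * kpoly A)%type.
Implicit Types x y z : forms.

(* The pair [(p, q)] stands for the form [p(t) + dt q(t)]. *)
Definition path_pi n x : forms := (polymap (pi n) x.1, polymap (pi (n - 1)) x.2).
(** The minus sign comes from [d] passing the odd symbol [dt]. *)
Definition path_d x : forms := (polymap d x.1, tder x.1 - polymap d x.2).
(** The bracket [t [,]_l + dt psi] extended to forms. As [dt] squares to zero, [psi] sees only the
    [dt]-free parts and the two [dt] parts never meet. *)
Definition path_br x y : forms :=
  (tmul (polymap2 br x.1 y.1),
   polymap2 psi x.1 y.1 + tmul (polymap2 br x.2 y.1 + polymap2 parbr x.1 y.2)).
Definition path_dgla : dgla K := @DGLA K forms path_pi path_d path_br.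

Fact fstL (c : K) x y : (c *: x + y).1 = c *: x.1 + y.1. Proof. by []. Qed.
Fact sndL (c : K) x y : (c *: x + y).2 = c *: x.2 + y.2. Proof. by []. Qed.
Let pairE := (fstL, sndL, linD fstL, linD sndL, linN fstL, linN sndL, linZ fstL, linZ sndL).

Lemma path_ext x y : (forall c, ev c x.1 = ev c y.1) ->
  (forall c, ev c x.2 = ev c y.2) -> x = y.
Proof.
by case: x y => [p q] [p' q'] /= /(ev_inj char0)-> /(ev_inj char0)->.
Qed.

Lemma homog_path n x : homog path_pi n x <->
  (forall c, homog pi n (ev c x.1)) /\ (forall c, homog pi (n - 1) (ev c x.2)).
Proof.
split=> [hx|[h1 h2]].
  by split=> c; rewrite /homog -(ev_polymap (piL _)); rewrite -{2}hx.
by apply: path_ext => c; rewrite /= (ev_polymap (piL _)) ?h1 ?h2.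
Qed.

Lemma homog_tder n x : homog path_pi n x -> forall c, homog pi n (ev c (tder x.1)).
Proof.
move=> hx c; rewrite /homog -(ev_polymap (piL _)) -(tder_polymap (piL _)).
by rewrite -{2}hx.
Qed.

Let evD c := linD (ev_lin (A := A) c).
Let evN c := linN (ev_lin (A := A) c).
Let evL c := ev_lin (A := A) c.
Let evbr c := @ev_polymap2 K A br brR brL c.
Let evpsi c := @ev_polymap2 K A psi psiR psiL c.
Let evparbr c := @ev_polymap2 K A parbr parbrR parbrL c.
Let evd c := @ev_polymap K A d dL c.
Let evZ c := linZ (ev_lin (A := A) c).
Let evE := (evZ, evD, evN, ev_tmul, evbr, evpsi, evparbr, evd).

Lemma path_grading : is_grading path_pi.
Proof.
split=> [n c x y|n m x|x].
- by apply: path_ext => b; rewrite /= !(pairE, ev_polymap (piL _), evL) (piL _ c).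
- apply: path_ext => c; rewrite /= !(ev_polymap (piL _)) pi_pi //.
    by case: eqP => _; rewrite ?(ev_polymap (piL _)) // (lin0 (evL c)).
  rewrite (inj_eq (addIr _)).
  by case: eqP => _; rewrite ?(ev_polymap (piL _)) // (lin0 (evL c)).
(* A polynomial has finitely many coefficients, each with finitely many homogeneous components. *)
have supp (p : kpoly A) : exists s : seq int, forall n, n \notin s -> polymap (pi n) p = 0.
  elim/poly_ind: p => [|p a [s ps]].
    exists [::] => n _; apply: (ev_inj char0) => c.
    by rewrite (ev_polymap (piL _)) !(lin0 (evL c)) (lin0 (piL _)).
  have [s' as'] := ex_supp gr a; exists (s ++ s') => n.
  rewrite mem_cat negb_or => /andP[/ps pn /as' an]; apply: (ev_inj char0) => c.
  rewrite (ev_polymap (piL _)) (evD c (tmul p) (pconst a)) ev_tmul ev_const.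
  by rewrite (piL _ c) an -(ev_polymap (piL _)) pn (lin0 (evL c)) scaler0 addr0.
have [s1 h1] := supp x.1; have [s2 h2] := supp x.2.
(* The support of the second component is translated by 1, the degree of [dt]. *)
pose s := undup (s1 ++ [seq n + 1 | n <- s2]); exists s.
split; first exact: undup_uniq.
apply: path_ext => c.
  rewrite (lin_sum fstL) (lin_sum (evL c)) /=; under eq_bigr do rewrite (ev_polymap (piL _)).
  apply: (sum_supp gr) (undup_uniq _) _ => n; rewrite mem_undup mem_cat negb_or.
  by case/andP=> /h1 p0 _; rewrite -(ev_polymap (piL _)) p0 (lin0 (evL c)).
rewrite (lin_sum sndL) (lin_sum (evL c)) /=; under eq_bigr do rewrite (ev_polymap (piL _)).
rewrite -(big_map (fun n => n - 1) predT (fun n => pi n (ev c x.2))).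
apply: (sum_supp gr) => [|n].
  by rewrite map_inj_uniq ?undup_uniq //; apply: addIr.
move=> ns; rewrite -(ev_polymap (piL _)) h2 ?(lin0 (evL c)) //.
apply: contra ns => ns2; rewrite -[n](addrK 1) (mem_map (addIr _)).
by rewrite mem_undup mem_cat (mem_map (addIr _)) ns2 orbT.
Qed.

(** The signs depend only on [a] and [b], so additivity frees the last argument, which is arbitrary
    in the Jacobi identity of [is_dgla]. *)
Lemma mixed_jacobi_linr m n a b c : homog pi m a -> homog pi n b ->
  psi a (br b c) + signed (odd `|m|) (br a (psi b c)) =
  psi (br a b) c + br (psi a b) c + signed (odd `|m| && odd `|n|)
    (psi b (br a c) + signed (odd `|n|) (br b (psi a c))).
Proof.
move=> ha hb; elim/(homog_ind gr): c => [|x y Ex Ey|q c hc].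
- rewrite !(lin0 (brR _), lin0 (psiR _)).
  by case: (odd `|m|) (odd `|n|) => [] []; rewrite /signed /=; zmodule.
- move: Ex Ey; rewrite !(linD (brR _), linD (psiR _)) => Ex Ey.
  have E := congr2 +%R Ex Ey; move: E {Ex Ey}.
  by case: (odd `|m|) (odd `|n|) => [] []; rewrite /signed /= => E; zmodule_from E.
exact: (db_mixed_jacobi D ha hb hc).
Qed.

Lemma derived_bracketE m a b : homog pi m a ->
  br a b = d (psi a b) + psi (d a) b + signed (odd `|m|) (psi a (d b)).
Proof.
move=> ha; elim/(homog_ind gr): b => [|x y Ex Ey|n b hb].
- rewrite !(lin0 (brR _), lin0 (psiR _), lin0 dL).
  by case: odd; rewrite /signed /=; zmodule.
- rewrite !(linD (brR _), linD (psiR _), linD dL) Ex Ey.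
  by case: odd; rewrite /signed /=; zmodule.
exact: (db_brE D ha hb).
Qed.

(** The [dt]-free components reduce to the axioms for [br]. In the [dt] components, the Jacobi
    identity also uses the mixed one, and the Leibniz rule uses that [br] is the differential of
    [psi]. *)
Lemma path_dglaP : is_dgla path_dgla.
Proof.
have [_ [_ [_ [dd [_ [_ [brg [brC [jac der]]]]]]]]] := br_dgla.
rewrite /= in dd brg brC jac der.
have P1 := parity_homog gr.
split; first exact: path_grading.
split => /= [c x y|].
  apply: path_ext => b /=; rewrite !(pairE, evE, tder_lin).
    by rewrite (linD dL) (linZ dL).
  by rewrite (linD dL) (linZ dL) !scalerDr scalerN; zmodule.
split => /= [n x hx|].
  have [h1 h2] := (homog_path n x).1 hx; apply/homog_path; split=> c /=; rewrite !evE.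
    exact: dg.
  rewrite addrK; apply: homogD => //; first exact: homog_tder.
  by apply: homogN => //; have := dg (h2 c); rewrite subrK.
split => /= [x|].
  apply: path_ext => c; rewrite /= !evE ?dd ?(lin0 (evL c)) // (tder_polymap dL) evE.
  by rewrite (linD dL) (linN dL) dd oppr0 addr0 subrr.
split => /= [a c x y|].
  apply: path_ext => b; rewrite /= !(pairE, evE, linD (brR _), linZ (brR _)).
    by rewrite scalerDr !scalerA mulrC.
  rewrite !(linD (psiR _), linZ (psiR _), linD (parbrR _), linZ (parbrR _)).
  by rewrite !scalerDr !scalerA [c * b]mulrC; zmodule.
split => /= [a c x y|].
  apply: path_ext => b; rewrite /= !(pairE, evE, linD (brL _), linZ (brL _)).
    by rewrite scalerDr !scalerA mulrC.
  rewrite !(linD (psiL _), linZ (psiL _), linD (parbrL _), linZ (parbrL _)).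
  by rewrite !scalerDr !scalerA [c * b]mulrC; zmodule.
split => /= [m n x y /homog_path[hx1 hx2] /homog_path[hy1 hy2]|].
  apply/homog_path; split=> c; rewrite /= !evE.
    by rewrite /homog (linZ (piL _)) brg.
  apply: homogD => //; [exact: (db_psi_deg D) | apply: homogZ => //].
  apply: homogD => //; first by have := brg _ _ _ _ (hx2 c) (hy1 c); rewrite addrAC.
  rewrite /parbr (P1 _ _ (hx1 c)) (linS (brL _)); apply: homogS => //.
  by rewrite -addrA; apply: brg.
split => /= [m n x y /homog_path[hx1 hx2] /homog_path[hy1 hy2]|].
  apply: path_ext => c; rewrite ?pairE /= ?pairE (linN (evL c)) (linZ (evL c)) !evE /parbr.
    by rewrite (brC _ _ _ _ (hx1 c) (hy1 c)) scalerN !scalerA mulrC.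
  rewrite (P1 _ _ (hx1 c)) (P1 _ _ (hy1 c)) !(linS (brL _)).
  rewrite (brC _ _ _ _ (hx2 c) (hy1 c)) (brC _ _ _ _ (hx1 c) (hy2 c)).
  rewrite (db_psiC D (hx1 c) (hy1 c)) !sgn_signed !oddzE.
  case: (odd `|m|) (odd `|n|) => [] []; rewrite /signed /= !(scalerDr, scalerN); zmodule.
split => /= [m n x y z /homog_path[hx1 hx2] /homog_path[hy1 hy2]|].
  apply: path_ext => c; rewrite ?pairE /= ?pairE (linD (evL c)) (linZ (evL c)) !evE /parbr.
    rewrite !(linZ (brR _), linZ (brL _)) (jac _ _ _ _ _ (hx1 c) (hy1 c)).
    by rewrite !sgn_signed /signed; case: ifP => _; rewrite !(scalerDr, scalerN).
  rewrite (P1 _ _ (hx1 c)) (P1 _ _ (hy1 c)) (linZ PL).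
  rewrite (P1 _ _ (brg _ _ _ _ (hx1 c) (hy1 c))) sgn_signed.
  (* The [dt] component of the Jacobi identity at [t = c]: [c] times the mixed identity, plus
     [c ^+ 2] times the Jacobi identity with the [dt] part taken from each argument in turn. *)
  have MJ := congr1 (GRing.scale c) (mixed_jacobi_linr (ev c z.1) (hx1 c) (hy1 c)).
  have J1 := congr1 (fun u => c *: (c *: u)) (jac _ _ _ _ (ev c z.1) (hx2 c) (hy1 c)).
  have J2 := congr1 (fun u => c *: (c *: u)) (jac _ _ _ _ (ev c z.1) (hx1 c) (hy2 c)).
  have J3 := congr1 (fun u => c *: (c *: u)) (jac _ _ _ _ (ev c z.2) (hx1 c) (hy1 c)).
  have := eq_addr (eq_addr MJ J1) (eq_addr (congr1 (signed (odd `|m|)) J2)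
    (congr1 (signed (odd `|m| (+) odd `|n|)) J3)).
  rewrite !sgn_signed !oddzE !(linS (brL _), linS (brR _), linZ (brL _), linZ (brR _),
    linD (brL _), linD (brR _), linZ (psiL _), linZ (psiR _), scalerDr, scalerS).
  by case: (odd `|m|) (odd `|n|) => [] []; rewrite /signed /= => E; zmodule_from E.
move=> m x y hx; have [hx1 hx2] := (homog_path m x).1 hx.
apply: path_ext => c; rewrite ?pairE /= ?pairE.
  by rewrite !evE (linZ dL) (der _ _ _ (hx1 c)) scalerDr !scalerA mulrC.
(* Differentiating the factor [t] leaves one extra [br x.1 y.1], which the differential of [psi]
   compensates. *)
rewrite tder_tmul (tder_polymap2 brR brL) !evE /parbr.
rewrite (P1 _ _ (hx1 c)) (P1 _ _ (dg (hx1 c))).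
have E := derived_bracketE (ev c y.1) (hx1 c).
rewrite !(linS (brL _), linD (brL _), linN (brL _), linD dL, linZ dL, linS dL).
rewrite (der _ _ _ (hx2 c)) (der _ _ _ (hx1 c)).
rewrite !sgn_signed !oddzE !(linD (brR _), linN (brR _), scalerDr, scalerS).
by move: E; case: odd; rewrite /signed /= !(scalerN) => E; zmodule_from E.
Qed.

(** The Poincare lemma, with integration in [t] starting at [c]; the factor [t] of the path bracket
    evaluates to [c]. *)
Lemma ev_quasi_iso (c : K) (br' : A -> A -> A) :
  (forall a b, br' a b = c *: br a b) ->
  @is_quasi_iso K path_dgla (DGLA pi d br') (fun x => ev c x.1).
Proof.
move=> br'E; split.
  split=> /= [b x y|n x|x|x y]; rewrite ?br'E.
  - exact: evL.
  - exact: ev_polymap (piL n) _ _.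
  - by rewrite !evE.
  - by rewrite !evE.
move=> n; split=> /= [[p q] _|y hy dy].
  case=> /= dp dq [y' dy'].
  have {dq} dq : tder p = polymap d q by apply/eqP; rewrite -subr_eq0 dq.
  (* The primitive is normalised to vanish at [t = c], so that [Q + pconst y'] takes the value [y']
     there. *)
  pose Q := primitive q - pconst (ev c (primitive q)).
  have dQ : tder Q = q.
    rewrite (linD (tder_lin (A := A))) (linN (tder_lin (A := A))) tder_const.
    by rewrite oppr0 addr0 tder_primitive.
  exists (Q + pconst y', 0); rewrite /path_d /=; congr pair; last first.
    rewrite (linD (tder_lin (A := A))) dQ tder_const addr0.
    apply: (ev_inj char0) => b.
    by rewrite !evE (lin0 (evL b)) (lin0 dL) subr0.
  (* Thus [p - d Q] is constant in [t], and its value at [c] is [d y']. *)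
  have R0 : tder (p - polymap d Q) = 0.
    rewrite (linD (tder_lin (A := A))) (linN (tder_lin (A := A))).
    by rewrite (tder_polymap dL) dQ dq subrr.
  have := tder_eq0 char0 R0; move: (ev 0 _) => r Rr.
  have evQ b : ev b p - d (ev b Q) = r.
    by rewrite -[r](ev_const b) -Rr !evE.
  have evQc : ev c Q = 0 by rewrite !evE ev_const subrr.
  apply: (ev_inj char0) => b; rewrite evd evD ev_const (linD dL) dy'.
  have Eb := evQ b; have Ec := evQ c; rewrite evQc (lin0 dL) in Ec.
  by rewrite -Ec in Eb; zmodule_from Eb.
(* Constant paths lift every cycle exactly. *)
exists (pconst y, 0); split.
- apply/homog_path; split=> b /=; first by rewrite ev_const; exact: hy.
  by rewrite (lin0 (evL b)); apply: homog0.
- apply: path_ext => b; rewrite /= !evE ?ev_const ?dy ?(lin0 (evL b)) //.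
  by rewrite tder_const (lin0 (evL b)) (lin0 dL) subr0.
by exists 0; rewrite /= ev_const subrr (lin0 dL).
Qed.

Lemma derived_bracket_homotopy_abelian : homotopy_abelian (DGLA pi d br).
Proof.
pose M := DGLA pi d (fun _ _ => 0).
have MP : is_dgla M.
  split; first exact: gr.
  split; first exact: dL.
  split; first exact: dg.
  split; first exact: db_diffK D.
  do 2![split=> [? ? ? ?|]; first by rewrite scaler0 addr0].
  split=> [m n a b _ _|]; first exact: homog0.
  split=> [m n a b _ _|]; first by rewrite scaler0 oppr0.
  by split=> [m n a b c _ _|m a b _] /=; rewrite scaler0 addr0 ?(lin0 dL).
exists M; split=> //.
apply: (@qi_trans _ _ path_dgla); first apply: qi_sym.
  by apply: qi_step path_dglaP br_dgla (ev_quasi_iso (c := 1) _) => a b; rewrite scale1r.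
by apply: qi_step path_dglaP MP (ev_quasi_iso (c := 0) _) => a b; rewrite scale0r.
Qed.
End PathObject.

(** * The bracket of a quasi-BV operator *)

Lemma second_order_ext (A : nzRingType) (H : bool -> A -> Prop) p (f g : A -> A) :
  f =1 g -> second_order H p f -> second_order H p g.
Proof. by move=> fg Sf u v w a b c Ha Hb Hc; rewrite -!fg; apply: Sf. Qed.

Section KoszulBracket.
Variables (K : fieldType) (A : algType K) (pi : int -> A -> A).
Variables (d i l : A -> A) (k : int).
Hypothesis dgca : is_dgca pi d.
Hypothesis iBV : quasi_BV pi (- (2 * k)) i.

Hypothesis l_def : l = gcomm (- (2 * k)) 1 i d.
Let br := bracket_l pi l.
Let s : int := 2 * k - 1.

Hypothesis liBV :
  quasi_BV pi ((1 - 2 * k) + - (2 * k)) (gcomm (1 - 2 * k) (- (2 * k)) l i).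

Let gr : is_grading pi. Proof. by case: dgca. Qed.
Let dL : is_lin d. Proof. by case: dgca => _ [_ [_ [_ []]]]. Qed.
Let iL : is_lin i. Proof. by case: iBV. Qed.
Let dg : op_deg pi 1 d. Proof. by case: dgca => _ [_ [_ [_ [_ []]]]]. Qed.
Let ig : op_deg pi (- (2 * k)) i. Proof. by case: iBV. Qed.
Let PL := parity_lin gr.

(** The instance of the predicate [H] through which the parity calculus of super-commutative rings
    applies to [A]. *)
Let Par (b : bool) (x : A) : Prop := exists2 n, homog pi n x & odd `|n| = b.

Lemma homog_par n x : homog pi n x -> Par (odd `|n|) x.
Proof. by exists n. Qed.

Fact odd_2k : odd `|2 * k| = false. Proof. lia. Qed.
Let oddkE := (oddzD, oddzN, odd_2k, oddzM).

Let homogM m n a b : homog pi m a -> homog pi n b -> homog pi (m + n) (a * b).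
Proof. by case: dgca => _ [_ [h _]]; apply: h. Qed.

Let HM u v a b : Par u a -> Par v b -> Par (u (+) v) (a * b).
Proof.
by move=> [m ha <-] [n hb <-]; exists (m + n); [apply: homogM | rewrite oddzD].
Qed.

Let HC u v a b : Par u a -> Par v b -> a * b = signed (u && v) (b * a).
Proof.
move=> [m ha <-] [n hb <-]; case: dgca => _ [_ [_ [C _]]].
by rewrite (C _ _ _ _ ha hb) sgn_signed oddzM.
Qed.

Let additive_opP p f : is_lin f -> op_deg pi p f -> additive_op Par (odd `|p|) f.
Proof.
move=> fL fg; split=> [|u a [n ha <-]]; first exact: linD.
by exists (n + p); [apply: fg | rewrite oddzD addbC].
Qed.

Lemma commutatorE x : l x = i (d x) - d (i x).
Proof. by rewrite l_def /gcomm sgn_signed !oddkE. Qed.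

Let lL : is_lin l.
Proof.
move=> c x y; rewrite !commutatorE !(linD dL, linZ dL, linD iL, linZ iL) scalerBr; zmodule.
Qed.

Let lg : op_deg pi (1 - 2 * k) l.
Proof.
move=> n x hx; rewrite commutatorE; apply: homogD => //; last apply: homogN => //.
  by have := ig (dg hx); rewrite -addrA.
by have := dg (ig hx); rewrite -addrA [_ + 1]addrC.
Qed.

Let Ad : additive_op Par true d. Proof. exact: additive_opP dL dg. Qed.
Let Ai : additive_op Par false i.
Proof. by have := additive_opP iL ig; rewrite oddzN odd_2k. Qed.
Let Al : additive_op Par true l.
Proof. by have := additive_opP lL lg; rewrite !oddkE. Qed.

Let dM u a b : Par u a -> d (a * b) = d a * b + signed u (a * d b).
Proof.
case=> n ha <-; case: dgca => _ [_ [_ [_ [_ [_ [_ dM]]]]]].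
by rewrite (dM _ _ _ ha) sgn_signed.
Qed.

Lemma gcomm_tricomm p m n q (f : A -> A) a b c x :
  gcomm (p + m + n) q (gcomm (p + m) n (gcomm p m f (lmul a)) (lmul b)) (lmul c) x
  = tricomm (odd `|p|) (odd `|m|) (odd `|n|) (odd `|q|) f a b c x.
Proof. by rewrite /gcomm /lmul /tricomm !sgn_signed !oddzE. Qed.

Lemma quasi_BV_second_order p f : quasi_BV pi p f -> second_order Par (odd `|p|) f.
Proof.
case=> fL fg f1 T; apply: (second_order_tricomm HM HC) => //.
  exact: additive_opP.
by move=> u v w a b c [m ha <-] [n hb <-] [q hc <-]; rewrite -gcomm_tricomm T.
Qed.

Let Si : second_order Par false i.
Proof. by have := quasi_BV_second_order iBV; rewrite oddzN odd_2k. Qed.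

(** By the Leibniz rule for triple commutators, those of [l] are sums of triple commutators of [i]
    and of the image under [d] of one such; all of these vanish. *)
Lemma quasi_BV_commutator : quasi_BV pi (1 - 2 * k) l.
Proof.
split=> //.
  have d1 : d 1 = 0.
    have h1 : Par false 1 by exists 0 => //; case: dgca => _ [].
    by apply: (addrI (d 1)); rewrite addr0 -{3}[1]mulr1 (dM _ h1) mulr1 mul1r.
  by rewrite commutatorE d1; case: iBV => _ _ -> _; rewrite (lin0 dL) (lin0 iL) subrr.
move=> m n q a b c ha hb hc x; rewrite gcomm_tricomm !oddkE /=.
have T m' n' q' a' b' c' x' : homog pi m' a' -> homog pi n' b' -> homog pi q' c' ->
    tricomm false (odd `|m'|) (odd `|n'|) (odd `|q'|) i a' b' c' x' = 0.
  move=> ha' hb' hc'; case: iBV => _ _ _ /(_ _ _ _ _ _ _ ha' hb' hc' x').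
  by rewrite gcomm_tricomm oddzN odd_2k.
have -> : tricomm true (odd `|m|) (odd `|n|) (odd `|q|) l a b c x =
    tricomm true (odd `|m|) (odd `|n|) (odd `|q|) (fun y => i (d y) - d (i y)) a b c x.
  by rewrite /tricomm !commutatorE.
rewrite (tricomm_derivation Ad dM _ Ai (homog_par ha) (homog_par hb) (homog_par hc)).
have := T _ _ _ _ _ _ x (dg ha) hb hc; have := T _ _ _ _ _ _ x ha (dg hb) hc.
have := T _ _ _ _ _ _ x ha hb (dg hc); rewrite !oddzD !addbT => -> -> ->.
rewrite !(T _ _ _ _ _ _ _ ha hb hc) (lin0 dL).
by rewrite /signed; do !case: ifP => _; zmodule.
Qed.

Let Sl : second_order Par true l.
Proof. by have := quasi_BV_second_order quasi_BV_commutator; rewrite !oddkE. Qed.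

Let Sli : second_order Par true (fun x => l (i x) - i (l x)).
Proof.
have := quasi_BV_second_order liBV; rewrite !oddkE /=.
by apply: second_order_ext => x; rewrite /gcomm sgn_signed !oddkE.
Qed.

Let psi a b := - (i (parity pi a * b) - i (parity pi a) * b - parity pi a * i b).

Lemma homotopyE n a b : homog pi n a ->
  psi a b = - signed (odd `|n|) (defect false (odd `|n|) i a b).
Proof.
move=> ha; rewrite /psi (parity_homog gr ha) !signed_mulr !(linS iL) signed_mulr /defect.
by rewrite /signed /=; case: ifP => _; zmodule.
Qed.

Lemma bracket_lE n a b : homog pi n a ->
  br a b = signed (odd `|n|) (defect true (odd `|n|) l a b).
Proof.
move=> ha; rewrite /br /bracket_l (parity_homog gr ha) !signed_mulr !(linS lL).
rewrite signed_mulr /defect.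
by rewrite /signed /=; case: ifP => _; zmodule.
Qed.

Let psiR a : is_lin (psi a).
Proof.
move=> c x y; rewrite /psi !(mulrDr, linD iL) -?scalerAr !(linZ iL) -?scalerAr.
by rewrite !(scalerDr, scalerN); zmodule.
Qed.

Let psiL b : is_lin (psi^~ b).
Proof.
move=> c x y; rewrite /psi !(linD PL, linZ PL) !(mulrDl, linD iL) -?scalerAl !(linZ iL).
by rewrite ?mulrDl -?scalerAl !(scalerDr, scalerN); zmodule.
Qed.

Let brR a : is_lin (br a).
Proof.
move=> c x y; rewrite /br /bracket_l !(mulrDr, linD lL) -?scalerAr !(linZ lL) -?scalerAr.
by rewrite ?mulrDr -?scalerAr !(scalerDr, scalerN); zmodule.
Qed.

Let brL b : is_lin (br^~ b).
Proof.
move=> c x y; rewrite /br /bracket_l !(linD PL, linZ PL) !(mulrDl, linD lL) -?scalerAl.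
by rewrite !(linZ lL) ?mulrDl -?scalerAl !(scalerDr, scalerN); zmodule.
Qed.

Lemma defect_deg p (f : A -> A) m n u a b : is_lin f -> op_deg pi p f ->
  homog pi m a -> homog pi n b -> homog pi (m + n + p) (defect (odd `|p|) u f a b).
Proof.
move=> fL fg ha hb; apply: homogD => //; first apply: homogD => //.
- exact: fg (homogM ha hb).
- by apply: homogN => //; have := homogM (fg _ _ ha) hb; rewrite addrAC.
- by apply: homogN => //; apply: homogS => //; have := homogM ha (fg _ _ hb); rewrite addrA.
Qed.

Lemma koszul_derived_bracket : derived_bracket (shift_grading pi s) d psi br.
Proof.
(* The shift [s] is odd, so parities in [A] are opposite to shifted ones; this turns the graded
   symmetry of [Phi_i] into the antisymmetry of [psi]. *)
have odds m : odd `|m + s| = ~~ odd `|m| by lia.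
have hi m n a b : homog pi m a -> homog pi n b -> forall u,
    homog pi (m + n + - (2 * k)) (defect false u i a b).
  move=> ha hb u; have := defect_deg u iL ig ha hb.
  by rewrite oddzN odd_2k.
have hl m n a b : homog pi m a -> homog pi n b -> forall u,
    homog pi (m + n + (1 - 2 * k)) (defect true u l a b).
  move=> ha hb u; have := defect_deg u lL lg ha hb.
  by rewrite !oddkE.
split=> //.
- exact: (shift_gradingP gr s).
- by move=> n x hx; rewrite /homog /shift_grading addrAC; apply: dg.
- by case: dgca => _ [_ [_ [_ [_ [_ []]]]]].
- move=> m n a b ha hb; rewrite (homotopyE b ha) /homog /shift_grading.
  have -> : m + n - 1 + s = m + s + (n + s) + - (2 * k) by rewrite /s; lia.
  by apply: (homogN gr); apply: (homogS gr); apply: hi.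
- move=> m n a b ha hb; rewrite (homotopyE b ha) (homotopyE a hb).
  rewrite (defectC HC Ai (homog_par ha) (homog_par hb)) !odds.
  by case: (odd `|m|) (odd `|n|) => [] []; rewrite /signed /=; zmodule.
- move=> m n a b ha hb.
  rewrite (bracket_lE b ha) (homotopyE b ha) (homotopyE b (dg ha)) (homotopyE (d b) ha).
  have -> : defect true (odd `|m + s|) l a b =
      defect true (odd `|m + s|) (fun y => i (d y) - d (i y)) a b.
    by rewrite /defect !commutatorE.
  rewrite (defect_derivation Ad dM Ai (homog_par ha) (homog_par hb)).
  rewrite [odd `|m + s + 1|]oddzD !odds addbT (linN dL) (linS dL).
  by case: (odd `|m|) => /=; rewrite /signed /=; zmodule.
move=> m n q a b c ha hb hc.
have := defect_jacobi HC Al Ai Sl Si Sli (homog_par ha) (homog_par hb) (homog_par hc).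
set u := odd `|m + s|; set v := odd `|n + s|; set w := odd `|q + s|.
rewrite (bracket_lE c hb) (homotopyE c hb) (bracket_lE b ha) (homotopyE b ha).
rewrite (bracket_lE c ha) (homotopyE c ha) -/u -/v.
rewrite !(linN (brR _), linS (brR _), linN (brL _), linS (brL _)).
rewrite !(linN (psiR _), linS (psiR _), linN (psiL _), linS (psiL _)).
rewrite (homotopyE _ ha) (bracket_lE _ ha) (homotopyE _ hb) (bracket_lE _ hb).
rewrite (homotopyE _ (hl _ _ _ _ ha hb u)) (bracket_lE _ (hi _ _ _ _ ha hb u)) -/u -/v.
(* In [defect_jacobi] the element [b] is the second entry of these outer defects, whereas here it is
   the first. *)
rewrite (defectC HC Ai (homog_par hb) (homog_par (hl _ _ _ _ ha hc u))).
rewrite (defectC HC Al (homog_par hb) (homog_par (hi _ _ _ _ ha hc u))).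
have ol x y : odd `|x + s + (y + s) + (1 - 2 * k)| = ~~ (odd `|x| (+) odd `|y|) by lia.
have oi x y : odd `|x + s + (y + s) + - (2 * k)| = odd `|x| (+) odd `|y| by lia.
rewrite !ol !oi /u /v /w !odds.
by case: (odd `|m|) (odd `|n|) (odd `|q|) => [] [] [];
  rewrite /signed /= => E; zmodule_from E.
Qed.
(** The derivation property of [Phi_l] in its second argument, extended additively to arbitrary
    [c]. *)
Lemma bracket_l_poisson m n a b c : homog pi m a -> homog pi n b ->
  br a (b * c) = br a b * c + sgn K ((m - s) * n) *: (b * br a c).
Proof.
move=> ha hb; rewrite sgn_signed oddzM.
have -> : odd `|m - s| = ~~ odd `|m| by rewrite /s; lia.
elim/(homog_ind gr): c => [|x y Ex Ey|q c hc].
- rewrite (lin0 (brR a)) !mulr0 (lin0 (brR a)).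
  by rewrite /signed; case: ifP => _; zmodule.
- rewrite [b * (x + y)]mulrDr !(linD (brR a)) Ex Ey.
  rewrite [br a b * (x + y)]mulrDr [b * (br a x + br a y)]mulrDr.
  by rewrite /signed; case: ifP => _; zmodule.
rewrite !(bracket_lE _ ha).
rewrite (defect_biderivation HM HC Al Sl (homog_par ha) (homog_par hb) (homog_par hc)).
rewrite signed_mulr mulr_signed.
by case: (odd `|m|) (odd `|n|) => [] []; rewrite /signed /=; zmodule.
Qed.

(** Compatibility of [l] with [d] is [[[i,d],d] = 0]: the terms containing [d] twice in a row vanish
    and the two terms [d i d] cancel. *)
Lemma commutator_dgBV : (forall x, l (l x) = 0) -> is_dgBV pi d (1 - 2 * k) l.
Proof.
move=> ll; split=> //; first by lia.
  exact: quasi_BV_commutator.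
move=> x; rewrite /gcomm sgn_signed !oddkE !commutatorE /=.
case: dgca => _ [_ [_ [_ [_ [_ [dd _]]]]]].
by rewrite !(linD dL, linN dL) !dd (lin0 iL); zmodule.
Qed.
End KoszulBracket.

Theorem theorem4p3 (K : fieldType) (A : algType K) (pi : int -> A -> A)
    (d : A -> A) (i : A -> A) (k : int) :
  [pchar K] =i pred0 ->
  is_dgca pi d ->
  quasi_BV pi (- (2 * k)) i ->
  let l := gcomm (- (2 * k)) 1 i d in
  quasi_BV pi ((1 - 2 * k) + - (2 * k)) (gcomm (1 - 2 * k) (- (2 * k)) l i) ->
  [/\ is_gerstenhaber pi d (2 * k - 1) (bracket_l pi l),
      homotopy_abelian (shifted_dgla pi (2 * k - 1) d (bracket_l pi l))
    & (forall x, l (l x) = 0) -> is_dgBV pi d (1 - 2 * k) l].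
Proof.
move=> char0 dgca iBV l liBV.
have D := koszul_derived_bracket dgca iBV erefl liBV; split.
- split=> //; split=> [|m n a b c].
    exact: derived_bracket_dgla (natr_neq0 char0 1) D.
  exact: (bracket_l_poisson dgca iBV erefl).
- exact: derived_bracket_homotopy_abelian char0 D.
- exact: (commutator_dgBV dgca iBV erefl).
Qed.
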